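(* Consider an $n$-level optimization problem with scalar variables $x_1,\dots,x_n\in\mathbb{R}$, and let $x_i^*(x_1,\dots,x_{i-1})$, $2\le i\le n$, be the (assumed unique and differentiable) best-response maps: $x_n^*(x_1,\dots,x_{n-1})=\operatorname{argmin}_{x_n} f_n(x_1,\dots,x_n)$ and, for $k=n-1,\dots,2$, $x_k^*(x_1,\dots,x_{k-1})=\operatorname{argmin}_{x_k} f_k(x_1,\dots,x_k,x_{k+1}^*,\dots,x_n^* )$ with the higher-index best responses evaluated recursively. Define $X_1(x_1)=x_1$ and $X_i(x_1)=x_i^*(x_1,X_2(x_1),\dots,X_{i-1}(x_1))$ for $i\ge 2$. Suppose there is $K\ge 0$ with $\big|\frac{\partial x_i^*}{\partial x_j}\big|\le K$ everywhere for all $1\le j<i\le n$. Let $M,N,S\ge 0$ be arbitrary constants and $J=\max\{M,N,K,S,1\}$. Then there is a constant $C$, independent of $i$ and $x_1$, such that for every $2\le i\le n$ and every $x_1\in\mathbb{R}$, $$\Big|\frac{\mathrm{d} X_i}{\mathrm{d} x_1}(x_1)\Big|\le C\big((i-1)J\big)^{i-1}.$$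
   Context: $\frac{\partial x_i^*}{\partial x_j}$ is the partial derivative of the best-response map $x_i^*$ with respect to its argument $x_j$; $\frac{\mathrm{d} X_i}{\mathrm{d} x_1}$ is the total derivative of the composite best response with respect to $x_1$. (In the paper $M,N,S$ are bounds on other derivatives; they play no role in the hypotheses here beyond entering $J$.) *)

(* Defs.v *)
From HB Require Import structures.
From mathcomp Require Import all_boot all_order all_algebra.
From mathcomp Require Import all_classical all_reals all_analysis.
Set Implicit Arguments. Unset Strict Implicit. Unset Printing Implicit Defensive.
Import Order.TTheory GRing.Theory Num.Theory.
Import numFieldNormedType.Exports.
Local Open Scope ring_scope.

(* Variables are 0-indexed: coordinate k of a row vector v : 'rV[R]_n
   stands for the paper's x_{k+1}. *)

Definition set_coord (R : realType) (n : nat) (v : 'rV[R]_n) (m : nat) (a : R)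
  : 'rV[R]_n := \row_j (if (j : nat) == m then a else v 0 j).

Fixpoint fill_from (R : realType) (n : nat) (br : nat -> 'rV[R]_n -> R)
  (m cnt : nat) (v : 'rV[R]_n) : 'rV[R]_n :=
  match cnt with
  | 0 => v
  | cnt'.+1 => fill_from br m.+1 cnt' (set_coord v m (br m v))
  end.

Definition complete (R : realType) (n : nat) (br : nat -> 'rV[R]_n -> R)
  (m : nat) (v : 'rV[R]_n) : 'rV[R]_n := fill_from br m (n - m) v.

(* The composite best-response path: X x1 = (X_1(x1), ..., X_n(x1)). *)
Definition Xpath (R : realType) (n : nat) (br : nat -> 'rV[R]_n -> R) (x1 : R)
  : 'rV[R]_n := complete br 1 (\row_j x1).

Definition depends_on_prefix (R : realType) (n : nat) (br : nat -> 'rV[R]_n -> R)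
  (k : nat) : Prop :=
  forall v w : 'rV[R]_n, (forall j : 'I_n, (j < k)%N -> v 0 j = w 0 j) ->
    br k v = br k w.

Definition unique_argmin_br (R : realType) (n : nat) (f br : nat -> 'rV[R]_n -> R)
  (k : nat) : Prop :=
  forall (v : 'rV[R]_n) (t : R), t != br k v ->
    f k (complete br k.+1 (set_coord v k (br k v)))
      < f k (complete br k.+1 (set_coord v k t)).

(* Main.v *)
Require Import Defs.
From HB Require Import structures.
From mathcomp Require Import all_boot all_order all_algebra.
From mathcomp Require Import all_classical all_reals all_analysis.
From mathcomp Require Import zify.
Set Implicit Arguments. Unset Strict Implicit. Unset Printing Implicit Defensive.
Import Order.TTheory GRing.Theory Num.Theory.
Import numFieldNormedType.Exports.
Local Open Scope ring_scope.

(* Coordinate j >= 1 of the best-response path is br j applied to the path,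
   and br j only sees the coordinates l < j.  By the chain rule, X_j' is a sum
   of the partial derivatives of br j (each bounded by K) against X_l', l < j,
   so by strong induction |X_j'| <= 1 + K + K (1 + K) + ... = (1 + K)^j.  Since
   i J >= 1, the constant C = (1 + K)^n then does the job. *)

Lemma diff_comp_row (R : numFieldType) (n : nat) (g : 'rV[R]_n -> R)
    (c : 'I_n -> R -> R) (t : R) :
  (forall l, differentiable (c l) t) -> differentiable g (\row_l c l t) ->
  differentiable (g \o (fun s => \row_l c l s)) t /\
  'd (g \o (fun s => \row_l c l s)) t 1 =
    \sum_l 'd (c l) t 1 * 'D_(delta_mx 0 l) g (\row_l c l t).
Proof.
move=> dc dg.
have rowE : (fun s => \row_l c l s) = \sum_l (fun s => c l s *: delta_mx 0 l).
  apply/funext => s; rewrite [LHS]row_sum_delta fct_sumE.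
  by apply: eq_bigr => l _; rewrite mxE.
have dW : differentiable (fun s => \row_l c l s) t.
  by rewrite rowE; apply: differentiable_sum => l; exact: differentiableZl.
split; first exact: differentiable_comp.
rewrite diff_comp //= -[X in 'd g _ X]deriveE // rowE derive_sum; last first.
  by move=> l; apply: diff_derivable; exact: differentiableZl.
rewrite raddf_sum; apply: eq_bigr => l _.
rewrite deriveE; last exact: differentiableZl.
by rewrite diffZl //= linearZ /= [in RHS]deriveE.
Qed.

Section BestResponsePath.
Variables (R : realType) (n : nat) (br : nat -> 'rV[R]_n -> R).
Hypothesis hdep : forall k : nat, (1 <= k < n)%N -> depends_on_prefix br k.

Lemma fill_fromE (cnt m : nat) (v : 'rV[R]_n) (j : 'I_n) : (1 <= m)%N ->
  fill_from br m cnt v 0 j =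
    if (m <= j < m + cnt)%N then br j (fill_from br m cnt v) else v 0 j.
Proof.
elim: cnt m v j => [|cnt IH] m v j hm /=.
  by have -> : (m <= j < m + 0)%N = false by lia.
set v' := set_coord v m (br m v).
have v'E (l : 'I_n) : v' 0 l = if (l : nat) == m then br m v else v 0 l.
  by rewrite mxE.
rewrite IH; last by lia.
have [jm|jm] := eqVneq (j : nat) m.
  have -> : (m.+1 <= j < m.+1 + cnt)%N = false by lia.
  have -> : (m <= j < m + cnt.+1)%N = true by lia.
  rewrite v'E jm eqxx; apply: hdep => [|l lm]; first by rewrite hm -jm ltn_ord.
  rewrite IH; last by lia.
  have -> : (m.+1 <= l < m.+1 + cnt)%N = false by lia.
  by rewrite v'E (ltn_eqF lm).
have -> : (m.+1 <= j < m.+1 + cnt)%N = (m <= j < m + cnt.+1)%N by lia.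
by case: ifP => // _; rewrite v'E (negbTE jm).
Qed.

Lemma XpathE (t : R) (j : 'I_n) :
  Xpath br t 0 j = if (1 <= j)%N then br j (Xpath br t) else t.
Proof.
rewrite /Xpath /complete fill_fromE //.
have -> : (1 <= j < 1 + (n - 1))%N = (1 <= j)%N by have := ltn_ord j; lia.
by case: ifP => // _; rewrite mxE.
Qed.

Local Notation X j := (fun s : R => Xpath br s 0 j).

Lemma Xpath_coord0 (j : 'I_n) : (j : nat) = 0%N -> X j = id.
Proof. by move=> j0; apply/funext => s; rewrite XpathE j0. Qed.

Lemma Xpath_coord_comp (j : 'I_n) (c : 'I_n -> R -> R) : (1 <= j)%N ->
  (forall l : 'I_n, (l < j)%N -> c l =1 X l) ->
  X j = br j \o (fun s => \row_l c l s).
Proof.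
move=> j1 cX; apply/funext => s /=; rewrite XpathE j1.
by apply: hdep => [|l lj]; [rewrite j1 ltn_ord | rewrite mxE cX].
Qed.

Hypothesis hdiff : forall (k : nat) (v : 'rV[R]_n), (1 <= k < n)%N ->
  differentiable (br k) v.
Variable K : R.
Hypothesis hK : forall (k : nat) (j : 'I_n) (v : 'rV[R]_n), (j < k < n)%N ->
  `| 'D_(delta_mx 0 j) (br k) v | <= K.

Lemma Xpath_coord_diff_bound (j : 'I_n) (t : R) :
  differentiable (X j) t /\ `| 'd (X j) t 1 | <= (1 + K) ^+ j.
Proof.
move: t; have [m] := ubnP j; elim: m j => // m IH j jm t.
have [j0|j1] := leqP (j : nat) 0%N.
  have {}j0 : (j : nat) = 0%N by lia.
  rewrite Xpath_coord0 // j0 expr0.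
  have did : differentiable (@id R) t by apply/derivable1_diffP; exact: derivable_id.
  by split => //; rewrite -deriveE // derive_id normr1.
pose c (l : 'I_n) : R -> R := if (l < j)%N then X l else cst 0.
have dc l : differentiable (c l) t.
  by rewrite /c; case: ifP => lj; [apply: (IH l _ t).1; lia | exact: differentiable_cst].
have dbr : differentiable (br j) (\row_l c l t) by apply: hdiff; rewrite j1 ltn_ord.
have [dX dXE] := diff_comp_row dc dbr.
rewrite (@Xpath_coord_comp j c) // => [|l lj s]; last by rewrite /c lj.
split => //; rewrite dXE.
have termE (l : 'I_n) : `|'d (c l) t 1 * 'D_(delta_mx 0 l) (br j) (\row_l c l t)|
    <= if (l < j)%N then (1 + K) ^+ l * K else 0.
  rewrite /c; case: ifP => lj; last by rewrite diff_cst mul0r normr0.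
  rewrite normrM; apply: ler_pM => //; first by apply: (IH l _ t).2; lia.
  by apply: hK; rewrite lj ltn_ord.
apply: le_trans (ler_norm_sum _ _ _) _; apply: le_trans (ler_sum _ (fun l _ => termE l)) _.
rewrite -big_mkcond /= -(big_ord_widen _ (fun l => (1 + K) ^+ l * K) (ltnW (ltn_ord j))).
rewrite -mulr_suml mulrC.
have -> : K * \sum_(l < j) (1 + K) ^+ l = (1 + K) ^+ j - 1.
  by rewrite subrX1 addrAC subrr add0r.
by rewrite gerBl.
Qed.

End BestResponsePath.

Theorem lemma7 (R : realType) (n : nat)
  (f br : nat -> 'rV[R]_n -> R) (K M N S : R)
  (hdep : forall k : nat, (1 <= k < n)%N -> depends_on_prefix br k)
  (hargmin : forall k : nat, (1 <= k < n)%N -> unique_argmin_br f br k)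
  (hdiff : forall (k : nat) (v : 'rV[R]_n), (1 <= k < n)%N -> differentiable (br k) v)
  (hK0 : 0 <= K) (hM0 : 0 <= M) (hN0 : 0 <= N) (hS0 : 0 <= S)
  (hK : forall (k : nat) (j : 'I_n) (v : 'rV[R]_n), (j < k < n)%N ->
          `| 'D_(delta_mx 0 j) (br k) v | <= K) :
  let J := Num.max M (Num.max N (Num.max K (Num.max S 1))) in
  exists C : R, forall (i : 'I_n) (x1 : R), (1 <= i)%N ->
    `| derive1 (fun t : R => Xpath br t 0 i) x1 | <= C * (i%:R * J) ^+ i.
Proof.
move=> J; exists ((1 + K) ^+ n) => i x1 i1.
have [dX dXbound] := Xpath_coord_diff_bound hdep hdiff hK i x1.
rewrite derive1E' //; apply: le_trans dXbound _.
have K1 : 1 <= 1 + K by rewrite lerDl.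
have J1 : 1 <= J by rewrite /J !le_max lexx !orbT.
apply: le_trans (ler_weXn2l K1 (ltnW (ltn_ord i))) _.
rewrite ler_peMr ?exprn_ge0 ?(le_trans ler01 K1) // exprn_ege1 //.
by apply: (le_trans J1); rewrite ler_peMl ?ler1n // (le_trans ler01 J1).
Qed.
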